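(* Let $(X_i)_{i\ge1}$ be independent $\mathbb{Z}_+$-valued random variables, and for $0\le a<n$ set $S_{a,n}:=\sum_{i=a+1}^n X_i$. For $i,d\in\mathbb N$ define \[ q(i,d):=\min\{P[X_i=0]\,P[X_{i+d}=i+d],\ P[X_i=i]\,P[X_{i+d}=0]\}, \] and for $\psi>0$ let $E(d,\psi):=\{i\in\mathbb N:\ q(i,d)\ge \psi/(i+d)\}$. Let $r,s\in\mathbb N$ be coprime and set $D:=\{r\}\cup\{s2^g:\ g\ge 0\}$. Suppose that for some $k\in\mathbb N$ and $\psi>0$, \[ E(d,\psi)\cap\{jk+1,\dots,(j+1)k\}\neq\emptyset\qquad\text{for all } d\in D \text{ and all } j\ge 1. \] Then there exist constants $C,\gamma>0$, depending only on $r,s,k$ and $\psi$, such that \[ d_{TV}\big(\mathcal L(S_{a,n}),\mathcal L(S_{a,n}+1)\big)\le 6\{(a+1)/n\}^{\gamma} \] for all integers $0\le a<n$ with $a+1\le Cn$.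
   Context: $d_{TV}$ denotes total variation distance between probability distributions on $\mathbb Z$, and $\mathcal L(Y)$ denotes the law of a random variable $Y$. *)

(* Defs.v *)
From HB Require Import structures.
From mathcomp Require Import all_boot all_order all_algebra finmap.
From mathcomp Require Import all_classical all_reals all_analysis.
From mathcomp Require Import measurable_realfun.

Set Implicit Arguments.
Unset Strict Implicit.
Unset Printing Implicit Defensive.

Import Order.TTheory GRing.Theory Num.Theory.
Import numFieldNormedType.Exports.

Local Open Scope classical_set_scope.
Local Open Scope ring_scope.

HB.instance Definition _ := isPointed.Build int 0.

(* The power-set sigma-algebra on int, as the library has on nat. *)
HB.instance Definition _ := @isMeasurable.Build default_measure_display
  int discrete_measurable discrete_measurable0
  discrete_measurableC discrete_measurableU.

(* Normalized so that d_TV <= 1 (no factor 2). *)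
Definition d_TV (d : measure_display) (T : measurableType d) (R : realType)
    (mu nu : probability T R) : R :=
  sup [set `|fine (mu A) - fine (nu A)| | A in measurable].

Definition independent_RVs (d d' : measure_display) (T : measurableType d)
    (T' : measurableType d') (R : realType) (P : probability T R)
    (I : choiceType) (D : set I) (X : I -> {RV P >-> T'}) : Prop :=
  forall (J : {fset I}) (A : I -> set T'),
    [set` J] `<=` D -> (forall i, i \in J -> measurable (A i)) ->
    P (\bigcap_(i in [set` J]) (X i @^-1` A i)) =
    (\prod_(i <- J) P (X i @^-1` A i))%E.

Section sums.
Context (d : measure_display) (T : measurableType d) (R : realType)
  (P : probability T R).

Definition partial_sum (X : nat -> {RV P >-> nat}) (a n : nat) : T -> int :=
  fun w => (\sum_(a.+1 <= i < n.+1) X i w)%N%:Z.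

Lemma measurable_partial_sum (X : nat -> {RV P >-> nat}) (a n : nat) :
  measurable_fun [set: T] (partial_sum X a n).
Proof.
apply: (@measurableT_comp _ _ _ _ _ _ Posz) => //.
elim: (index_iota a.+1 n.+1) => [|i s IHs].
  by under eq_fun do rewrite big_nil; exact: measurable_cst.
under eq_fun do rewrite big_cons.
by apply: measurable_fun_addn => //; exact: measurable_funP.
Qed.

HB.instance Definition _ (X : nat -> {RV P >-> nat}) (a n : nat) :=
  isMeasurableFun.Build _ _ _ _ (partial_sum X a n)
    (measurable_partial_sum X a n).

Definition add_one (Y : {mfun T >-> int}) : T -> int := fun w => Y w + 1.

Lemma measurable_add_one (Y : {mfun T >-> int}) :
  measurable_fun [set: T] (add_one Y).
Proof.
by apply: (@measurableT_comp _ _ _ _ _ _ (fun z : int => z + 1)).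
Qed.

HB.instance Definition _ (Y : {mfun T >-> int}) :=
  isMeasurableFun.Build _ _ _ _ (add_one Y) (measurable_add_one Y).

Definition prob_eq (Y : {RV P >-> nat}) (m : nat) : R :=
  fine (P [set w | Y w = m]).

Definition q (X : nat -> {RV P >-> nat}) (i e : nat) : R :=
  Num.min (prob_eq (X i) 0 * prob_eq (X (i + e)%N) (i + e))
          (prob_eq (X i) i * prob_eq (X (i + e)%N) 0).

Definition E (X : nat -> {RV P >-> nat}) (e : nat) (psi : R) : set nat :=
  [set i | (0 < i)%N /\ psi / (i + e)%:R <= q X i e].

End sums.

Definition D (r s : nat) : set nat :=
  [set r] `|` [set (s * 2 ^ g)%N | g in [set: nat]].

(* Main.v *)
Require Import Defs.
From HB Require Import structures.
From mathcomp Require Import all_boot all_order all_algebra finmap.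
From mathcomp Require Import all_classical all_reals all_analysis.
From mathcomp Require Import measurable_realfun zify ring lra.

Import Order.TTheory GRing.Theory Num.Theory.
Import numFieldNormedType.Exports.

Local Open Scope classical_set_scope.
Local Open Scope ring_scope.

(* A Mineka-type coupling, run as a recursion for the distance F(t, del) between the
   laws of S_(t,n) and S_(t,n) + del.  A pair (X_i, X_(i+e)) with i in E(e, psi)
   replaces del by del + e or del - e, each with probability at least psi / (i + e).
   Starting from del = 1, steps +-r are used until s divides del; from then on the
   step is e = s 2^v, with 2^v the exact power of 2 dividing del / s.  Each such step
   either brings del to 0 or doubles e, so the failure probability decreases
   geometrically in the number of effective steps.  A window of O(e) indices above t
   contains about e / k disjoint pairs at distance e, hence yields an effective step
   with probability of order e / (t + e), which makes (t + B e)^gam * weight(del)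
   a supermartingale along the recursion when gam is small. *)

(** * Two elementary inequalities *)

(** Induction from [(1 - x) (1 + (N+1) x) <= 1 + N x]. It turns the probability that [N] attempts
    all fail into a bound rational in [N x]. *)
Lemma exprBn_le (R : realType) (x : R) (N : nat) : 0 <= x <= 1 ->
  (1 - x) ^+ N * (1 + N%:R * x) <= 1.
Proof.
move=> /andP[x0 x1]; elim: N => [|N IHN]; first by rewrite expr0 mul0r addr0 mul1r.
apply: le_trans IHN; rewrite exprSr -mulrA; apply: ler_wpM2l.
  by rewrite exprn_ge0// subr_ge0.
rewrite -natr1; have : 0 <= N%:R * x * x + x * x :> R.
  by rewrite addr_ge0 ?mulr_ge0.
lra.
Qed.

(** Compare with exponentials: [(1 + x)^gam <= exp (gam x)] and [1 - z <= exp (-z)]. A contraction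
    [1 - z] thus pays for the growth of a time factor. *)
Lemma powR_decay (R : realType) (b x z gam : R) : 0 <= b -> 0 <= x -> 0 <= gam ->
  gam * x <= z -> (b * (1 + x)) `^ gam * (1 - z) <= b `^ gam.
Proof.
move=> b0 x0 gam0 gxz; rewrite powRM//; last by lra.
rewrite -mulrA -[leRHS]mulr1; apply: ler_wpM2l; first exact: powR_ge0.
have hx : (1 + x) `^ gam <= expR (gam * x).
  rewrite mulrC expRM; apply: ge0_ler_powR => //; rewrite ?nnegrE ?expR_ge0//.
  - by lra.
  - exact: expR_ge1Dx.
apply: (@le_trans _ _ ((1 + x) `^ gam * expR (- z))).
  by apply: ler_wpM2l; [exact: powR_ge0 | exact: expR_ge1Dx].
apply: le_trans (ler_wpM2r (expR_ge0 _) hx) _.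
by rewrite -expRD -expR0 ler_expR subr_le0.
Qed.

(** * The potential *)

Lemma modz_unique (x y m : int) : 0 <= y < m -> (m %| x - y)%Z -> (x %% m)%Z = y.
Proof.
move=> /andP[y0 ym]; rewrite -eqz_mod_dvd => /eqP ->.
by rewrite modz_small//; lia.
Qed.

(* With u the unique element of [0, s) such that s divides del + r u, the steps
   +r and -r move u by -1 and +1, and 1 + u (s - u) has discrete Laplacian -2. *)
Lemma exists_hitting_weight (R : realType) (r s : nat) : (0 < s)%N -> coprime r s ->
  exists g : int -> R,
    (forall del, 1 <= g del <= 1 + s%:R ^+ 2) /\
    (forall del, ~~ (s %| `|del|)%N ->
      g (del + r%:Z) + g (del - r%:Z) <= 2 * g del - 2).
Proof.
move=> s0 rs; have [ri [c ric]] := Bezoutz r s.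
have {}ric : ri * r%:Z = 1 - c * s%:Z.
  have g1 : gcdz r s = 1 by rewrite /gcdz !absz_nat (eqP rs).
  by rewrite -g1 -ric; ring.
(* [ri] inverts [r] modulo [s], so this residue solves [s | del + r u]. *)
pose u del : int := ((- (del * ri)) %% s%:Z)%Z.
have s0Z : (s%:Z != 0 :> int) by lia.
have u0 del : 0 <= u del < s%:Z.
  by rewrite modz_ge0//= ltz_pmod.
exists (fun del => 1 + (u del * (s%:Z - u del))%:~R); split=> del.
  have := u0 del; set v := u del => /andP[v0 vs].
  rewrite lerDl lerD2l (_ : s%:R ^+ 2 = (s%:Z * s%:Z)%:~R); last first.
    by rewrite intrM expr2.
  rewrite ler0z ler_int; apply/andP; split; nia.
move=> sdel.
have uE : (s%:Z %| - (del * ri) - u del)%Z.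
  by rewrite -eqz_mod_dvd modz_mod.
have [un0 us] : 0 < u del /\ u del < s%:Z.
  have /andP[v0 ->] := u0 del; rewrite lt_neqAle v0 andbT; split=> //.
  apply: contraNneq sdel => v0'; move: uE; rewrite -v0' subr0 dvdzE abszN abszM.
  rewrite absz_nat Gauss_dvdl//.
  rewrite coprime_sym /coprime; apply/eqP.
  have : coprimez ri s%:Z.
    by apply/coprimezP; exists (r%:Z, c) => /=; rewrite mulrC ric; ring.
  by rewrite coprimezE => /eqP.
have [z zE] := dvdzP uE.
have delri : del * ri = - (z * s%:Z + u del) by rewrite -zE; ring.
have up : u (del + r%:Z) = u del - 1.
  apply: modz_unique; first by lia.
  apply/dvdzP; exists (z + c).
  by rewrite mulrDl delri [r%:Z * ri]mulrC ric; ring.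
(* From [u = s - 1] the step [-r] wraps to 0 instead of [s]; [u (s - u)] vanishes at both, so the
   Laplacian is the same. *)
have um : (u del + 1 < s%:Z /\ u (del - r%:Z) = u del + 1) \/
          (u del + 1 = s%:Z /\ u (del - r%:Z) = 0).
  have e1 : - ((del - r%:Z) * ri) = z * s%:Z + u del + 1 - c * s%:Z.
    by rewrite mulrBl delri [r%:Z * ri]mulrC ric; ring.
  case: (ltP (u del + 1) s%:Z) => h; [left | right].
    split=> //; apply: modz_unique; first by lia.
    by apply/dvdzP; exists (z - c); rewrite e1; ring.
  have h' : u del + 1 = s%:Z by lia.
  split=> //; apply: modz_unique; first by lia.
  by apply/dvdzP; exists (z - c + 1); rewrite e1 -[z * _ + _ + _]addrA h'; ring.
have sum_intr (x y w : int) : x + y = 2 * w - 2 ->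
    1 + x%:~R + (1 + y%:~R) <= 2 * (1 + w%:~R) - 2 :> R.
  move=> /(congr1 (fun m : int => m%:~R : R)).
  by rewrite intrB intrM intrD (_ : 2%:~R = 2)//; lra.
by apply: sum_intr; rewrite up; case: um => -[h ->]; rewrite -?h; ring.
Qed.

Section potential.
Context (R : realType) (r s B : nat) (gam : R) (g : int -> R).
Hypotheses (r_gt0 : (0 < r)%N) (s_gt0 : (0 < s)%N).
Hypotheses (gam_gt0 : 0 < gam) (gam_le : gam <= 4^-1).

Let G : R := 1 + s%:R ^+ 2.
Hypothesis g_bounds : forall del, 1 <= g del <= G.
Hypothesis g_hit : forall del, ~~ (s %| `|del|)%N ->
  g (del + r%:Z) + g (del - r%:Z) <= 2 * g del - 2.

(** At [del = 0] the convention [logn 2 0 = 0] gives [s], so the stride is positive and in [D r s]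
    for every [del]. *)
Definition stride (del : int) : nat :=
  if (s %| `|del|)%N then (s * 2 ^ logn 2 (`|del| %/ s))%N else r.

(* On multiples of s, a step of +-stride del preserves the average of `|del| and
   at least doubles the stride, so the factor stride^(-1/2) makes the weight
   contract; elsewhere g contracts while steps of +-r search for a multiple of s. *)
Definition weight (del : int) : R :=
  if del == 0 then 0 else
  if (s %| `|del|)%N then `|del|%N%:R * (stride del)%:R `^ (- 2^-1)
  else (`|del|%N%:R + r%:R * G) * g del.

(* B * stride del bounds the number of indices consumed by one block of pairs, so
   the potential exceeds n^gam as soon as the indices up to n do not suffice. *)
Definition potential (t : nat) (del : int) : R :=
  (t + B * stride del)%:R `^ gam * weight del.

Lemma stride_gt0 (del : int) : (0 < stride del)%N.
Proof. by rewrite /stride; case: ifP => _ //; rewrite muln_gt0 s_gt0 expn_gt0. Qed.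

Lemma stride_D (del : int) : D r s (stride del).
Proof.
by rewrite /stride; case: ifP => _; [right; exists (logn 2 (`|del| %/ s)) | left].
Qed.

Lemma stride_le (del : int) : del != 0 -> (s %| `|del|)%N -> (stride del <= `|del|)%N.
Proof.
move=> del0 sdel; rewrite /stride sdel mulnC -leq_divRL//.
apply: dvdn_leq; last exact: pfactor_dvdnn.
by rewrite divn_gt0// dvdn_leq// absz_gt0.
Qed.

(** The factor [2^(v+1)] survives in [|del| / s], so the exact power of 2 there is at least twice
    [2^v]. *)
Lemma stride_double (del : int) (v c : nat) : del != 0 ->
  `|del|%N = (s * 2 ^ v.+1 * c)%N ->
  (s %| `|del|)%N /\ (2 * (s * 2 ^ v) <= stride del)%N.
Proof.
move=> del0 delE; have sdel : (s %| `|del|)%N by rewrite delE -mulnA dvdn_mulr.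
split=> //; rewrite /stride sdel delE -mulnA mulKn// mulnCA -expnS leq_pmul2l//.
rewrite leq_exp2l// -pfactor_dvdn ?dvdn_mulr//.
by move: del0; rewrite -absz_gt0 delE -mulnA muln_gt0 => /andP[].
Qed.

(** With [c = y' / y >= 1], the first factor grows by at most [c^gam <= c^(1/4)] and the second
    shrinks by [c^(-1/2)]. *)
Lemma powR_stride_decay (x y y' : R) : 0 <= x -> 0 < y -> y <= y' ->
  (x + B%:R * y') `^ gam * y' `^ (- 2^-1) <=
  (y' / y) `^ (- 4^-1) * ((x + B%:R * y) `^ gam * y `^ (- 2^-1)).
Proof.
move=> x0 y0 yy'; set c := y' / y; have y'0 : 0 < y' by exact: lt_le_trans yy'.
have c1 : 1 <= c by rewrite ler_pdivlMr// mul1r.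
have c0 : 0 <= c by lra.
have y'E : y' = c * y by rewrite divfK// gt_eqF.
have B0 : 0 <= B%:R :> R by [].
have By : 0 <= B%:R * y by rewrite mulr_ge0// ltW.
have -> : c `^ (- 4^-1) = c `^ 4^-1 * c `^ (- 2^-1).
  rewrite -powRD; last by apply/implyP => _; rewrite gt_eqF//; lra.
  by congr (_ `^ _); lra.
rewrite mulrACA {2}y'E powRM ?(ltW y0)//.
rewrite ler_wpM2r ?mulr_ge0 ?powR_ge0//.
apply: (@le_trans _ _ ((c * (x + B%:R * y)) `^ gam)).
  apply: ge0_ler_powR; first exact: ltW.
  - by rewrite nnegrE addr_ge0// mulr_ge0// ltW.
  - by rewrite nnegrE mulr_ge0// addr_ge0.
  - by rewrite mulrDr y'E (mulrCA B%:R) lerD2r ler_peMl.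
rewrite powRM//; last by rewrite addr_ge0.
by rewrite ler_wpM2r ?powR_ge0// ler_powR.
Qed.

Let potential_multiple (t : nat) (del : int) : (s %| `|del|)%N ->
  potential t del = `|del|%N%:R *
    ((t%:R + B%:R * (stride del)%:R) `^ gam * (stride del)%:R `^ (- 2^-1)).
Proof.
move=> sdel; rewrite /potential /weight sdel natrD natrM.
by case: eqP => [->|_]; [rewrite mul0r mulr0 | ring].
Qed.

(** On multiples of [s], [stride^(1/2) <= stride <= |del|]; elsewhere both factors are at least
    1. *)
Lemma weight_ge1 (del : int) : del != 0 -> 1 <= weight del.
Proof.
move=> del0; rewrite /weight (negPf del0).
have del1 : 1 <= `|del|%N%:R :> R by rewrite ler1n absz_gt0.
have r1 : 1 <= r%:R :> R by rewrite ler1n.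
case: ifP => sdel; last first.
  have /andP[g1 gG] := g_bounds del.
  have : 1 <= r%:R * G by rewrite mulr_ege1//; exact: le_trans gG.
  by move=> rG; rewrite mulr_ege1//; lra.
have d1 : 1 <= (stride del)%:R :> R by rewrite ler1n stride_gt0.
have d0 : 0 < (stride del)%:R :> R by lra.
rewrite powRN ler_pdivlMr ?powR_gt0// mul1r.
apply: (@le_trans _ _ (stride del)%:R); last by rewrite ler_nat stride_le.
by rewrite -[leRHS](powRr1 (ltW d0)) ler_powR//; lra.
Qed.

(** With [e] the stride, [|del|] is an odd multiple of [e], so [del + e] and [del - e] are multiples
    of [2 e]: each is 0 or has at least twice the stride, a gain of [2^(-1/4)]. Their absolute
    values sum to [2 |del|] because [e <= |del|]. *)
Let potential_step (rho : R) (t : nat) (del : int) :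
  2 `^ (- 4^-1) <= rho -> (s %| `|del|)%N -> del != 0 ->
  potential t (del + (stride del)%:Z) + potential t (del - (stride del)%:Z) <=
  2 * rho * potential t del.
Proof.
move=> rho_ge sdel del0; set e := stride del.
have e0 : 0 < e%:R :> R by rewrite ltr0n stride_gt0.
pose h := (t%:R + B%:R * e%:R) `^ gam * e%:R `^ (- 2^-1) : R.
have h0 : 0 <= h by rewrite mulr_ge0 ?powR_ge0.
have le_e := stride_le _ del0 sdel; rewrite -/e in le_e.
pose v := logn 2 (`|del| %/ s).
have eE : e = (s * 2 ^ v)%N by rewrite /e /stride sdel.
have [c cE] : exists c, `|del|%N = (e * (2 * c + 1))%N.
  have A0 : (0 < `|del| %/ s)%N by rewrite divn_gt0// dvdn_leq// absz_gt0.
  have [m mo mE] := @pfactor_coprime 2 _ isT A0.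
  exists m./2; rewrite eE -{1}(divnK sdel) mE -/v.
  have -> : (2 * m./2 + 1 = m)%N.
    rewrite -[RHS]odd_double_half -mul2n addnC; move: mo.
    by rewrite coprime2n => ->.
  by rewrite mulnC mulnCA mulnC.
have step del' : (exists c', `|del'|%N = (s * 2 ^ v.+1 * c')%N) ->
    potential t del' <= `|del'|%N%:R * (rho * h).
  move=> [c' del'E]; have [->|del'0] := eqVneq del' 0.
    by rewrite /potential /weight eqxx mulr0 mul0r.
  have [sdel' le2] := stride_double _ _ _ del'0 del'E; rewrite -eE in le2.
  rewrite potential_multiple//; apply: ler_wpM2l => //.
  apply: le_trans (powR_stride_decay _ _ _ _ e0 _) _ => //.
    by rewrite ler_nat; lia.
  rewrite -/h; apply: ler_wpM2r => //; apply: le_trans rho_ge.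
  rewrite !powRN lef_pV2 ?posrE ?powR_gt0// ?divr_gt0// ?ltr0n ?stride_gt0//.
  apply: ge0_ler_powR; rewrite ?nnegrE ?divr_ge0//.
  by rewrite ler_pdivlMr// -natrM ler_nat.
have eqD : (`|(del + e%:Z)%R| = `|del| + e)%N /\ (`|(del - e%:Z)%R| = `|del| - e)%N \/
           (`|(del + e%:Z)%R| = `|del| - e)%N /\ (`|(del - e%:Z)%R| = `|del| + e)%N.
  by move: le_e; clear; lia.
have evenD : exists c', (`|del| + e)%N = (s * 2 ^ v.+1 * c')%N.
  by exists c.+1; rewrite cE expnS mulnCA -eE; lia.
have evenB : exists c', (`|del| - e)%N = (s * 2 ^ v.+1 * c')%N.
  by exists c; rewrite cE expnS mulnCA -eE; lia.
have hp : potential t (del + e%:Z) <= `|(del + e%:Z)%R|%N%:R * (rho * h).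
  by apply: step; case: eqD => -[-> _].
have hm : potential t (del - e%:Z) <= `|(del - e%:Z)%R|%N%:R * (rho * h).
  by apply: step; case: eqD => -[_ ->].
apply: le_trans (lerD hp hm) _; rewrite potential_multiple// -/e -/h -mulrDl -natrD.
rewrite (_ : `|(del + e%:Z)%R| + `|(del - e%:Z)%R| = 2 * `|del|)%N; last first.
  by move: le_e eqD; clear; lia.
by rewrite natrM; lra.
Qed.

(** The linear factor grows at most by [1 + 1/G], as [r = (r G) / G], while the Laplacian bound and
    [g <= G] shrink the mean of [g] by [1 - 1/G]; the product is [1 - G^(-2)]. *)
Let potential_hit (rho : R) (t : nat) (del : int) :
  1 - G ^- 2 <= rho -> ~~ (s %| `|del|)%N ->
  potential t (del + r%:Z) + potential t (del - r%:Z) <= 2 * rho * potential t del.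
Proof.
move=> rho_ge sdel; have del0 : del != 0.
  by apply: contraNneq sdel => ->; rewrite absz0 dvdn0.
have r1 : 1 <= r%:R :> R by rewrite ler1n.
have G1 : 1 <= G by have /andP[] := g_bounds 0; exact: le_trans.
pose h : R := (t%:R + B%:R * r%:R) `^ gam; have h0 : 0 <= h by exact: powR_ge0.
have rG0 : 0 <= r%:R * G by rewrite mulr_ge0//; lra.
(* The expression used off the multiples of [s] dominates the potential everywhere; at a multiple,
   its stride is compared with 1 through [powR_stride_decay]. *)
have step del' : potential t del' <= h * ((`|del'|%N%:R + r%:R * G) * g del').
  have /andP[g1 _] := g_bounds del'.
  have [del'0|del'0] := eqVneq del' 0.
    rewrite {1}/potential /weight del'0 eqxx mulr0 -del'0; apply: mulr_ge0 => //.
    by apply: mulr_ge0; [exact: addr_ge0 | lra].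
  have [sdel'|sdel'] := boolP (s %| `|del'|)%N; last first.
    rewrite /potential /weight (negPf del'0) (negPf sdel').
    by rewrite /stride (negPf sdel') natrD natrM.
  rewrite potential_multiple//.
  have d1 : 1 <= (stride del')%:R :> R by rewrite ler1n stride_gt0.
  have dec := powR_stride_decay _ _ _ (ler0n R t) ltr01 d1.
  apply: (@le_trans _ _ (h * `|del'|%N%:R)); last first.
    apply: ler_wpM2l => //; rewrite -[leLHS]mulr1.
    by apply: ler_pM => //; lra.
  rewrite mulrC; apply: ler_wpM2r => //; apply: le_trans dec _.
  rewrite powR1 !mulr1 divr1; apply: (@le_trans _ _ (1 * (t%:R + B%:R) `^ gam)).
    apply: ler_wpM2r; first exact: powR_ge0.
    have d1' : 1 <= (stride del')%:R `^ 4^-1 :> R.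
      by rewrite -[leLHS](powRr0 (stride del')%:R) ler_powR.
    by rewrite powRN invf_le1//; exact: lt_le_trans d1'.
  rewrite mul1r; apply: ge0_ler_powR; first exact: ltW.
  - by rewrite nnegrE addr_ge0.
  - by rewrite nnegrE addr_ge0// mulr_ge0.
  - by rewrite lerD2l ler_peMr.
have le_abs del' : (`|del'| <= `|del| + r)%N ->
    potential t del' <= h * ((`|del|%N%:R + r%:R + r%:R * G) * g del').
  move=> le_del; apply: le_trans (step _) _; apply: ler_wpM2l => //.
  apply: ler_wpM2r; first by have /andP[] := g_bounds del'; lra.
  by rewrite lerD2r -natrD ler_nat.
have hp := le_abs (del + r%:Z) ltac:(clear; lia).
have hm := le_abs (del - r%:Z) ltac:(clear; lia).
have potE : potential t del = h * ((`|del|%N%:R + r%:R * G) * g del).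
  rewrite /potential /weight (negPf del0) (negPf sdel).
  by rewrite /stride (negPf sdel) natrD natrM.
apply: le_trans (lerD hp hm) _; rewrite potE -mulrDr -mulrDr [leRHS]mulrCA.
apply: ler_wpM2l => //.
have /andP[g1 gG] := g_bounds del.
have GV : G * G^-1 = 1 by rewrite divff// gt_eqF//; lra.
have GV0 : 0 < G^-1 by rewrite invr_gt0; lra.
set x : R := `|del|%N%:R; have x0 : 0 <= x by [].
have f1 : x + r%:R + r%:R * G <= (x + r%:R * G) * (1 + G^-1).
  have : 0 <= x * G^-1 by rewrite mulr_ge0// ltW.
  have : r%:R * G * G^-1 = r%:R by rewrite -mulrA GV mulr1.
  lra.
have f2 : g (del + r%:Z) + g (del - r%:Z) <= 2 * (g del * (1 - G^-1)).
  apply: le_trans (g_hit _ sdel) _.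
  by have := ler_wpM2r (ltW GV0) gG; rewrite GV; lra.
have s0 : 0 <= g (del + r%:Z) + g (del - r%:Z).
  have /andP[? _] := g_bounds (del + r%:Z).
  by have /andP[? _] := g_bounds (del - r%:Z); lra.
apply: le_trans (ler_pM _ s0 f1 f2) _; first by lra.
have -> : (x + r%:R * G) * (1 + G^-1) * (2 * (g del * (1 - G^-1))) =
    2 * (1 - G ^- 2) * ((x + r%:R * G) * g del).
  by rewrite -exprVn; ring.
apply: ler_wpM2r; last by lra.
by rewrite mulr_ge0//; lra.
Qed.

Lemma potential_contract (rho : R) (t : nat) (del : int) :
  2 `^ (- 4^-1) <= rho -> 1 - G ^- 2 <= rho -> del != 0 ->
  potential t (del + (stride del)%:Z) + potential t (del - (stride del)%:Z) <=
  2 * rho * potential t del.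
Proof.
move=> rho1 rho2 del0; have [sdel|sdel] := boolP (s %| `|del|)%N.
  exact: potential_step.
by rewrite {1 2}/stride (negPf sdel); exact: potential_hit.
Qed.

End potential.

(** * Total variation between a sum and its shifts *)

Section shifted_sums.
Context {d : measure_display} {T : measurableType d} {R : realType}
  (P : probability T R) (X : nat -> {RV P >-> nat}).

Definition pr (A : set T) : R := fine (P A).

Lemma prE (A : set T) : measurable A -> P A = (pr A)%:E.
Proof. by move=> mA; rewrite /pr fineK// fin_num_measure. Qed.

Lemma pr_ge0 (A : set T) : 0 <= pr A.
Proof. exact: fine_ge0. Qed.

Lemma pr_setT : pr setT = 1.
Proof. by rewrite /pr probability_setT. Qed.

Lemma pr_le1 (A : set T) : measurable A -> pr A <= 1.
Proof. by move=> mA; rewrite -lee_fin -prE// probability_le1. Qed.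

Lemma probability_partition (Z : {RV P >-> nat}) (A : set T) : measurable A ->
  P A = (\sum_(0 <= z <oo) P (A `&` Z @^-1` [set z]))%E.
Proof.
move=> mA; rewrite -measure_semi_bigcup.
- by congr (P _); apply/seteqP; split=> [w Aw|w [z _ []]//]; exists (Z w).
- by move=> z; apply: measurableI => //; exact: measurable_funPTI.
- by move=> i j _ _ [w [[_ /= <-] [_ /= <-]]].
- apply: bigcup_measurable => z _.
  by apply: measurableI => //; exact: measurable_funPTI.
Qed.

(** Countable additivity over the values of [Z]: an inequality between events may be checked with
    one summand frozen. *)
Lemma pr_le_partition (Z : {RV P >-> nat}) (A1 A2 G : set T) (v : R) :
  measurable A1 -> measurable A2 -> measurable G -> 0 <= v ->
  (forall z, pr (A1 `&` Z @^-1` [set z]) <=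
    pr (A2 `&` Z @^-1` [set z]) + v * pr (G `&` Z @^-1` [set z])) ->
  pr A1 <= pr A2 + v * pr G.
Proof.
move=> mA1 mA2 mG v0 le_z.
have mZ A z : measurable A -> measurable (A `&` Z @^-1` [set z]).
  by move=> mA; apply: measurableI => //; exact: measurable_funPTI.
rewrite -lee_fin EFinD EFinM -!prE//.
rewrite (probability_partition Z _ mA1) (probability_partition Z _ mA2).
rewrite (probability_partition Z _ mG) -nneseriesZl// -nneseriesD//; last first.
  by move=> i _ _; rewrite mule_ge0.
apply: lee_nneseries => // z _.
by rewrite !prE ?lee_fin; [exact: le_z | exact: mZ..].
Qed.

(** * Independence for sums over lists of indices *)

Definition sum_over (l : seq nat) (w : T) : int := (\sum_(i <- l) X i w)%N%:Z.

Lemma sum_over_cons (i : nat) (l : seq nat) (w : T) :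
  sum_over (i :: l) w = (X i w)%:Z + sum_over l w.
Proof. by rewrite /sum_over big_cons PoszD. Qed.

Lemma perm_sum_over (l l' : seq nat) : perm_eq l l' -> sum_over l = sum_over l'.
Proof. by move=> ll'; apply/funext => w; rewrite /sum_over (perm_big _ ll'). Qed.

Lemma measurable_sum_over (l : seq nat) : measurable_fun [set: T] (sum_over l).
Proof.
apply: (@measurableT_comp _ _ _ _ _ _ Posz) => //.
elim: l => [|i l IHl].
  by under eq_fun do rewrite big_nil; exact: measurable_cst.
under eq_fun do rewrite big_cons.
by apply: measurable_fun_addn => //; exact: measurable_funP.
Qed.

Lemma measurable_sum_over_event (l : seq nat) (A : set int) :
  measurable [set w | A (sum_over l w)].
Proof. by rewrite -[X in measurable X]setTI; exact: measurable_sum_over. Qed.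

Definition cylinder (J : seq nat) (B : nat -> set nat) : set T :=
  [set w | forall i, i \in J -> B i (X i w)].

Lemma cylinder_bigcap (J : seq nat) (B : nat -> set nat) :
  cylinder J B = \bigcap_(i in [set` [fset x in J]%fset]) (X i @^-1` B i).
Proof.
apply/seteqP; split=> w cw i /=; first by rewrite inE; exact: cw.
by move=> iJ; apply: cw; rewrite /= inE.
Qed.

Lemma measurable_cylinder (J : seq nat) (B : nat -> set nat) :
  measurable (cylinder J B).
Proof.
rewrite cylinder_bigcap bigcap_fset; apply: bigsetI_measurable => i _.
exact: measurable_funPTI.
Qed.

Hypothesis indepX : independent_RVs [set i : nat | (1 <= i)%N] X.

Lemma cylinder_cons (i : nat) (J : seq nat) (B : nat -> set nat) :
  uniq (i :: J) -> all (leq 1) (i :: J) ->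
  P (cylinder (i :: J) B) = (P (X i @^-1` B i) * P (cylinder J B))%E.
Proof.
have cylE l : uniq l -> all (leq 1) l ->
    P (cylinder l B) = (\prod_(i <- l) P (X i @^-1` B i))%E.
  move=> ul /allP l1; rewrite cylinder_bigcap indepX//=.
  - by apply: perm_big; rewrite uniq_perm ?fset_uniq// => j; rewrite inE.
  - by move=> j /=; rewrite inE; exact: l1.
move=> uJ J1; have [/andP[_ uJ'] /andP[_ J1']] := conj uJ J1.
by rewrite !cylE// big_cons.
Qed.

(** Induction on [l]: freezing [X i = x] moves the head of the sum into the cylinder, and summing
    over [x] recovers the product. *)
Lemma sum_over_cylinder (l J : seq nat) (A : set int) (B : nat -> set nat) :
  uniq (l ++ J) -> all (leq 1) (l ++ J) ->
  P ([set w | A (sum_over l w)] `&` cylinder J B) =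
  (P [set w | A (sum_over l w)] * P (cylinder J B))%E.
Proof.
elim: l J A B => [|i l IHl] J A B ulJ lJ1.
  rewrite (_ : [set w | _] = if `[< A 0 >] then setT else set0); last first.
    rewrite /sum_over; under eq_fun do rewrite big_nil.
    by case: asboolP => A0; apply/seteqP; split.
  by case: asboolP; rewrite ?setTI ?set0I ?probability_setT ?measure0 ?mul1e ?mul0e.
have mA := measurable_sum_over_event (i :: l) A.
(* Needed for two lists: [J] expands the left side, and the empty list resums the series to the
   probability of the sum event. *)
have key J' : uniq ((i :: l) ++ J') -> all (leq 1) ((i :: l) ++ J') -> forall x,
    P ([set w | A (sum_over (i :: l) w)] `&` cylinder J' B `&` X i @^-1` [set x]) =
    (P (cylinder J' B) *
      (P [set w | A (x%:Z + sum_over l w)%R] * P (X i @^-1` [set x])))%E.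
  move=> /= /andP[]; rewrite mem_cat negb_or => /andP[il iJ'] ulJ' /andP[i1].
  move=> lJ'1 x; pose B' j := if j == i then [set x] else B j.
  have BE : cylinder J' B' = cylinder J' B.
    have neJ j : j \in J' -> (j == i) = false.
      by move=> jJ; apply/eqP => ji; rewrite -ji jJ in iJ'.
    by apply/seteqP; split=> w cw j jJ; move: (cw j jJ); rewrite /B' neJ.
  have -> : [set w | A (sum_over (i :: l) w)] `&` cylinder J' B `&` X i @^-1` [set x]
      = [set w | A (x%:Z + sum_over l w)] `&` cylinder (i :: J') B'.
    apply/seteqP; split=> w /=.
      rewrite sum_over_cons => -[[Aw cw] Xi]; split; first by rewrite -Xi.
      move=> j; rewrite inE /B' => /orP[/eqP->|jJ]; first by rewrite eqxx.
      by case: ifP => [/eqP->|_]; [exact: Xi | exact: cw].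
    case=> Aw cw; have := cw i; rewrite inE eqxx /B' eqxx => /(_ isT) /= Xi.
    rewrite sum_over_cons Xi; split=> //; split=> // j jJ.
    have := cw j; rewrite inE jJ orbT /B' => /(_ isT).
    by case: eqP => // ji; rewrite ji (negPf iJ') in jJ.
  have u' : uniq (l ++ i :: J').
    by rewrite -cat1s uniq_catCA /= mem_cat negb_or il iJ'.
  have a' : all (leq 1) (l ++ i :: J').
    by move: lJ'1; rewrite !all_cat /= i1.
  rewrite (IHl _ [set z | A (x%:Z + z)])// cylinder_cons//.
  - by rewrite BE /B' eqxx muleA muleC.
  - by move: u'; rewrite cat_uniq => /and3P[].
  - by move: a'; rewrite all_cat => /andP[].
rewrite (probability_partition (X i) (_ `&` _)); last first.
  by apply: measurableI => //; exact: measurable_cylinder.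
under eq_eseriesr => x _ do rewrite (key J ulJ lJ1).
have mC := measurable_cylinder J B.
rewrite [in P (cylinder J B)]prE// nneseriesZl; last by move=> x _; rewrite mule_ge0.
rewrite muleC -prE//; congr (_ * _)%E.
rewrite (probability_partition (X i))//; apply: eq_eseriesr => x _.
have := key [::]; rewrite cats0 => /(_ _ _ x).
rewrite (_ : cylinder [::] B = setT); last by apply/seteqP; split.
rewrite probability_setT mul1e setIT => <- //.
- by move: ulJ; rewrite cat_uniq => /and3P[].
- by move: lJ1; rewrite all_cat => /andP[].
Qed.

Lemma pr_sum_over_eq2 (l : seq nat) (A : set int) (i j x y : nat) :
  uniq [:: i, j & l] -> all (leq 1) [:: i, j & l] ->
  pr ([set w | A (sum_over l w)] `&` X i @^-1` [set x] `&` X j @^-1` [set y]) =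
  pr [set w | A (sum_over l w)] * (prob_eq (X i) x * prob_eq (X j) y).
Proof.
move=> u1 a1; pose B h := if h == i then [set x] else [set y].
have ij : (j == i) = false.
  by move: u1 => /=; rewrite inE negb_or eq_sym => /andP[/andP[/negPf]].
have u2 : uniq (l ++ [:: i; j]) by rewrite uniq_catC.
have a2 : all (leq 1) (l ++ [:: i; j]).
  by move: a1; rewrite all_cat /= andbT => /and3P[-> -> ->].
have u3 : uniq [:: i; j] by move: u2; rewrite cat_uniq => /and3P[].
have a3 : all (leq 1) [:: i; j] by move: a2; rewrite all_cat => /andP[].
rewrite -setIA (_ : _ `&` X j @^-1` _ = cylinder [:: i; j] B); last first.
  apply/seteqP; split=> w /=.
    move=> [Xi Xj] h; rewrite !inE => /orP[]/eqP->; rewrite /B ?eqxx ?ij//.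
  move=> cw; split.
    by have := cw i; rewrite inE eqxx /B eqxx => /(_ isT).
  by have := cw j; rewrite !inE eqxx orbT /B ij => /(_ isT).
rewrite {1}/pr sum_over_cylinder// cylinder_cons//.
rewrite (cylinder_cons j [::])//; last by move: a3 => /= /andP[].
rewrite (_ : cylinder [::] B = setT); last by apply/seteqP; split.
rewrite probability_setT mule1 /B eqxx ij.
rewrite [P [set _ | _]]prE; last exact: measurable_sum_over_event.
rewrite [P (X i @^-1` _)]prE; last exact: measurable_funPTI.
by rewrite [P (X j @^-1` _)]prE; last exact: measurable_funPTI.
Qed.

Lemma pr_sum_over_eq (l : seq nat) (A : set int) (i x : nat) :
  uniq (i :: l) -> all (leq 1) (i :: l) ->
  pr ([set w | A (sum_over l w)] `&` X i @^-1` [set x]) =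
  pr [set w | A (sum_over l w)] * prob_eq (X i) x.
Proof.
move=> u1 a1; pose B (_ : nat) := [set x].
rewrite (_ : X i @^-1` [set x] = cylinder [:: i] B); last first.
  apply/seteqP; split=> w /=; first by move=> Xi h; rewrite inE => /eqP->.
  by move/(_ i); rewrite inE eqxx => /(_ isT).
have a2 : all (leq 1) (l ++ [:: i]) by rewrite all_cat /= andbT andbC.
have u2 : uniq (l ++ [:: i]) by rewrite uniq_catC.
rewrite {1}/pr sum_over_cylinder// (cylinder_cons i [::])//; last first.
  by move: a2; rewrite all_cat => /andP[].
rewrite (_ : cylinder [::] B = setT); last by apply/seteqP; split.
rewrite probability_setT mule1.
rewrite [P [set _ | _]]prE; last exact: measurable_sum_over_event.
by rewrite [P (X i @^-1` _)]prE; last exact: measurable_funPTI.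
Qed.

(** * Comparing a sum with its shift; exchanging the values of a pair *)

Lemma pr_setIC (A B : set T) : measurable A -> measurable B ->
  pr A = pr (A `&` B) + pr (A `&` ~` B).
Proof.
move=> mA mB; have mI := measurableI _ _ mA mB.
have mD : measurable (A `&` ~` B) by apply: measurableI => //; exact: measurableC.
apply: EFin_inj; rewrite EFinD -!prE// -measureU//.
  by rewrite -setIUr setUv setIT.
by rewrite setIACA setICr setI0.
Qed.

(** One-sided, but over all events: complements give the other side, so this bounds a total
    variation distance. Ranging over all [A] allows the event to be translated when summands are
    frozen. *)
Definition shift_le (l : seq nat) (del : int) (v : R) : Prop := forall A : set int,
  pr [set w | A (sum_over l w)] <= pr [set w | A (sum_over l w + del)] + v.

Lemma shift_leW (l : seq nat) (del : int) (v v' : R) :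
  v <= v' -> shift_le l del v -> shift_le l del v'.
Proof. by move=> vv' lv A; apply: le_trans (lv A) _; rewrite lerD2l. Qed.

Lemma shift_le0 (l : seq nat) : shift_le l 0 0.
Proof. by move=> A; under [in leRHS]eq_set do rewrite addr0; rewrite addr0. Qed.

Lemma shift_le_ge1 (l : seq nat) (del : int) (v : R) : 1 <= v -> shift_le l del v.
Proof.
move=> v1 A; have := pr_le1 _ (measurable_sum_over_event l A).
have := pr_ge0 [set w | A (sum_over l w + del)]; lra.
Qed.

Lemma shift_le_ge0 (l : seq nat) (del : int) (v : R) : shift_le l del v -> 0 <= v.
Proof. by move=> /(_ setT); rewrite lerDl. Qed.

(** An independent summand cannot increase the distance: given [X i = z], the event is only
    translated by [z]. *)
Lemma shift_le_cons (i : nat) (l : seq nat) (del : int) (v : R) :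
  uniq (i :: l) -> all (leq 1) (i :: l) ->
  shift_le l del v -> shift_le (i :: l) del v.
Proof.
move=> ul l1 lv A; have v0 := shift_le_ge0 _ _ _ lv.
rewrite -[v]mulr1 -pr_setT.
apply: (pr_le_partition (X i)) => //.
- exact: measurable_sum_over_event.
- exact: (measurable_sum_over_event _ [set z | A (z + del)]).
move=> z; pose A' := [set y : int | A (z%:Z + y)].
have -> : [set w | A (sum_over (i :: l) w)] `&` X i @^-1` [set z] =
    [set w | A' (sum_over l w)] `&` X i @^-1` [set z].
  by apply/seteqP; split=> w /= [+ Xi]; rewrite /A' sum_over_cons Xi.
have -> : [set w | A (sum_over (i :: l) w + del)] `&` X i @^-1` [set z] =
    [set w | A' (sum_over l w + del)] `&` X i @^-1` [set z].
  by apply/seteqP; split=> w /= [+ Xi]; rewrite /A' sum_over_cons Xi /= addrA.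
rewrite (pr_sum_over_eq _ A')// (pr_sum_over_eq _ [set y | A' (y + del)])// setTI.
rewrite -[pr (X i @^-1` _)]/(prob_eq (X i) z) -mulrDl.
by apply: ler_wpM2r; [exact: pr_ge0 | exact: lv].
Qed.

(** Lets a block work with its paired indices only and restore the others afterwards. *)
Lemma shift_le_subset (l l' : seq nat) (del : int) (v : R) :
  uniq l -> uniq l' -> all (leq 1) l' -> {subset l <= l'} ->
  shift_le l del v -> shift_le l' del v.
Proof.
move=> ul ul' l'1 ll' lv; pose m := [seq x <- l' | x \notin l].
have pm : perm_eq l' (m ++ l).
  apply: uniq_perm => //.
    rewrite cat_uniq filter_uniq//= ul andbT.
    by apply/hasPn => x xl; rewrite mem_filter xl.
  move=> x; rewrite mem_cat mem_filter.
  by case: (boolP (x \in l)) => [/ll' ->|]; rewrite ?orbT ?orbF.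
move: l'1 ul'; rewrite (perm_all _ pm) (perm_uniq pm) /shift_le.
rewrite (perm_sum_over _ _ pm).
elim: m {pm} => //= i m IH /andP[i1 m1] /andP[im um].
by apply: shift_le_cons; rewrite /= ?i1 ?im//; exact: IH.
Qed.

(* Mineka coupling: the outcomes (0, i + e) and (i, 0) of (X_i, X_(i+e)) are
   exchanged on mass p, which moves the two sums by e relative to each other. *)
Lemma shift_le_pair (l : seq nat) (i e : nat) (del : int) (p v vp vm : R) :
  uniq [:: i, (i + e)%N & l] -> all (leq 1) [:: i, (i + e)%N & l] ->
  0 <= p <= q X i e ->
  shift_le l del v -> shift_le l (del + e%:Z) vp -> shift_le l (del - e%:Z) vm ->
  shift_le [:: i, (i + e)%N & l] del ((1 - 2 * p) * v + p * (vp + vm)).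
Proof.
set j := (i + e)%N => ul l1 /andP[p0 pq] lv lvp lvm A.
have v0 := shift_le_ge0 _ _ _ lv.
have i1 : (1 <= i)%N by case/andP: l1.
have pri (h x : nat) : measurable (X h @^-1` [set x]) by exact: measurable_funPTI.
pose E1 := X i @^-1` [set 0%N] `&` X j @^-1` [set j].
pose E2 := X i @^-1` [set i] `&` X j @^-1` [set 0%N].
have mE1 : measurable E1 by exact: measurableI.
have mE2 : measurable E2 by exact: measurableI.
have E21 : E2 `&` ~` E1 = E2.
  apply/seteqP; split=> [w []//|w E2w]; split=> // -[/= X0 _].
  by case: E2w => /= Xi _; rewrite -Xi X0 in i1.
pose S := sum_over [:: i, j & l].
have cellE (B : set int) (x y : nat) :
    [set w | B (S w)] `&` X i @^-1` [set x] `&` X j @^-1` [set y] =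
    [set w | B (x%:Z + (y%:Z + sum_over l w))] `&` X i @^-1` [set x]
      `&` X j @^-1` [set y].
  by apply/seteqP; split=> w /= [[+ Xi] Xj]; rewrite /S !sum_over_cons Xi Xj.
have prE1 B : pr ([set w | B (S w)] `&` E1) =
    pr [set w | B (j%:Z + sum_over l w)] * (prob_eq (X i) 0 * prob_eq (X j) j).
  by rewrite setIA cellE -(pr_sum_over_eq2 _ [set z | B (j%:Z + z)]).
have prE2 B : pr ([set w | B (S w)] `&` E2) =
    pr [set w | B (i%:Z + sum_over l w)] * (prob_eq (X i) i * prob_eq (X j) 0).
  by rewrite setIA cellE -(pr_sum_over_eq2 _ [set z | B (i%:Z + z)]).
pose G := ~` E1 `&` ~` E2.
have mG : measurable G by apply: measurableI; exact: measurableC.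
have mS B : measurable [set w | B (S w)] by exact: measurable_sum_over_event.
have split3 B : pr [set w | B (S w)] =
    pr [set w | B (j%:Z + sum_over l w)] * (prob_eq (X i) 0 * prob_eq (X j) j) +
    pr [set w | B (i%:Z + sum_over l w)] * (prob_eq (X i) i * prob_eq (X j) 0) +
    pr ([set w | B (S w)] `&` G).
  rewrite (pr_setIC _ E1)// prE1.
  rewrite (pr_setIC ([set w | B (S w)] `&` ~` E1) E2)//; last first.
    by apply: measurableI => //; exact: measurableC.
  by rewrite -!setIA [~` E1 `&` E2]setIC E21 prE2 addrA.
pose B' := [set z : int | A (z + del)].
(* Off the two cells the pair is frozen at the same values on both sides, so the hypothesis at [del]
   suffices. *)
have rest : pr ([set w | A (S w)] `&` G) <= pr ([set w | B' (S w)] `&` G) + v * pr G.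
  apply: (pr_le_partition (X i)) => //; [exact: measurableI.. |].
  move=> x; apply: (pr_le_partition (X j)) => //;
    [by apply: measurableI => //; exact: measurableI.. | exact: measurableI |].
  move=> y.
  have GE (U : set T) : U `&` G `&` X i @^-1` [set x] `&` X j @^-1` [set y] =
      if `[< (x = 0%N /\ y = j) \/ (x = i /\ y = 0%N) >] then set0
      else U `&` X i @^-1` [set x] `&` X j @^-1` [set y].
    case: asboolP => xy; apply/seteqP; split=> w //=.
    - by move=> [[[_ [nE1 nE2]] Xi] Xj]; case: xy => -[xE yE];
        [apply: nE1 | apply: nE2]; rewrite /E1 /E2 /= Xi Xj.
    - by move=> [[[]]].
    - move=> [[Uw Xi] Xj]; split=> //; split=> //; split=> //.
      by split; rewrite /E1 /E2 /= Xi Xj => ?; apply: xy; [left | right].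
  have -> : G `&` X i @^-1` [set x] = [set: T] `&` G `&` X i @^-1` [set x].
    by rewrite setTI.
  rewrite !GE.
  case: asboolP => _; first by rewrite /pr measure0 /= mulr0 addr0.
  rewrite !cellE (pr_sum_over_eq2 _ [set z | A (x%:Z + (y%:Z + z))])//.
  rewrite (pr_sum_over_eq2 _ [set z | B' (x%:Z + (y%:Z + z))])//.
  rewrite (_ : setT = [set w | [set: int] (sum_over l w)])//.
  rewrite (pr_sum_over_eq2 _ [set: int])// (mulrA v) -mulrDl.
  apply: ler_wpM2r; first by rewrite mulr_ge0 // pr_ge0.
  rewrite [pr [set w | setT _]]pr_setT mulr1.
  have -> : [set w | [set z | B' (x%:Z + (y%:Z + z))] (sum_over l w)] =
      [set w | A (x%:Z + (y%:Z + (sum_over l w + del)))].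
    by apply/funext => w; rewrite /B' /= !addrA.
  exact: (lv [set z | A (x%:Z + (y%:Z + z))]).
have prG : pr G = 1 - prob_eq (X i) 0 * prob_eq (X j) j -
    prob_eq (X i) i * prob_eq (X j) 0.
  by have := split3 setT; rewrite setTI pr_setT; lra.
have lvA (c c' : nat) (del' : int) u : del = del' + c%:Z - c'%:Z ->
    shift_le l del' u ->
    pr [set w | A (c%:Z + sum_over l w)] <= pr [set w | B' (c'%:Z + sum_over l w)] + u.
  move=> delE /(_ [set z | A (c%:Z + z)]); rewrite /B' /= delE.
  by congr (_ <= pr _ + _); apply/funext => w; congr A; ring.
have jE : j%:Z = i%:Z + e%:Z by rewrite /j PoszD.
(* [h1] and [h2] keep the cell, on the mass in excess of [p]; [h3] and [h4] swap the cells on mass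
   [p], which changes [del] by [-e] and [+e]. *)
have h1 := lvA j j del v ltac:(ring) lv.
have h2 := lvA i i del v ltac:(ring) lv.
have h3 := lvA j i (del - e%:Z) vm ltac:(rewrite jE; ring) lvm.
have h4 := lvA i j (del + e%:Z) vp ltac:(rewrite jE; ring) lvp.
rewrite -[X in _ <= X + _]/(pr [set w | B' (S w)]) -/S !split3.
move: pq rest; rewrite prG /q le_min -/j => /andP[pq1 pq2] rest.
have := ler_wpM2l p0 h3; have := ler_wpM2l p0 h4.
have p1 : 0 <= prob_eq (X i) 0 * prob_eq (X j) j - p by rewrite subr_ge0.
have p2 : 0 <= prob_eq (X i) i * prob_eq (X j) 0 - p by rewrite subr_ge0.
have := ler_wpM2l p1 h1; have := ler_wpM2l p2 h2; lra.
Qed.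

(** * Blocks of pairs and the recursion *)

(** For [i > 0] the events [X i = 0] and [X i = i] are disjoint and [q] is at most either
    probability. This keeps [1 - 2 p] nonnegative in a block. *)
Lemma q_le_half (i e : nat) : (0 < i)%N -> 2 * q X i e <= 1.
Proof.
move=> i0; have m j x : measurable (X j @^-1` [set x]) by exact: measurable_funPTI.
have le1 j x : 0 <= prob_eq (X j) x <= 1.
  by apply/andP; split; [exact: pr_ge0 | exact: pr_le1 (m j x)].
have sum1 : prob_eq (X i) 0 + prob_eq (X i) i <= 1.
  have mU := measurableU _ _ (m i 0%N) (m i i).
  suff <- : pr (X i @^-1` [set 0%N] `|` X i @^-1` [set i]) =
    pr (X i @^-1` [set 0%N]) + pr (X i @^-1` [set i]) by exact: pr_le1.
  apply: EFin_inj; rewrite EFinD -!prE// measureU//.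
  by apply/seteqP; split=> w //= [-> i_eq0]; rewrite -i_eq0 in i0.
have le_l j x j' x' : prob_eq (X j) x * prob_eq (X j') x' <= prob_eq (X j) x.
  by rewrite ler_piMr//; case/andP: (le1 j x); case/andP: (le1 j' x').
have q1 : q X i e <= prob_eq (X i) 0 by rewrite ge_min le_l.
have q2 : q X i e <= prob_eq (X i) i by rewrite ge_min le_l orbT.
lra.
Qed.

(** About [e / k] disjoint pairs are tried in turn; the first exchange replaces [v] by the mean of
    [vp] and [vm], at most [rho v]. No exchange occurs with probability [(1 - 2 p)^N]. *)
Lemma shift_le_block (k e n t : nat) (psi : R) :
  (0 < k)%N -> (0 < e)%N -> 0 < psi ->
  (forall j, (1 <= j)%N ->
    E X e psi `&` [set i | (j * k + 1 <= i <= (j + 1) * k)%N] !=set0) ->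
  exists t', [/\ (t < t')%N, (t' <= t + (2 * k + 2) * e)%N & (t' <= n)%N ->
    forall (del : int) (rho v vp vm : R), rho <= 1 ->
    shift_le (index_iota t'.+1 n.+1) del v ->
    shift_le (index_iota t'.+1 n.+1) (del + e%:Z) vp ->
    shift_le (index_iota t'.+1 n.+1) (del - e%:Z) vm ->
    vp + vm <= 2 * rho * v ->
    shift_le (index_iota t.+1 n.+1) del
      (v * (1 - (1 - rho) * ((psi / k%:R) / (1 + psi / k%:R) *
        (e%:R / (t + (2 * k + 2) * e)%:R))))].
Proof.
move=> k0 e0 psi0 EX.
(* The quotient plus 1 puts the windows from [j0] on past [t] and secures [j0 >= 1]. *)
have [j0 [j00 j0t j0k]] : exists j0, [/\ 0 < j0, t < j0 * k & j0 * k <= t + k]%N.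
  exists (t %/ k).+1; rewrite mulSn; have := divn_eq t k; have := ltn_pmod t k0.
  by split=> //; lia.
(* [N] is [e / k] rounded down, but at least 1. When [N > 1], [N k <= e] keeps left members apart
   from right ones; a single pair is disjoint anyway. *)
have [N [N0 Nke eNk Nk1]] : exists N,
    [/\ 0 < N, N * k <= e + k, e <= 2 * (N * k) & (N == 1%N) || (N * k <= e)]%N.
  have := divn_eq e k; have := ltn_pmod e k0.
  case: (posnP (e %/ k)) => [-> _|ek0].
    rewrite mul0n => eE; exists 1%N; have := ltn_pmod e k0.
    by rewrite -[(e %% k)%N]eE; split=> //; lia.
  move=> ek eE; exists (e %/ k)%N; have : (k <= e %/ k * k)%N by rewrite leq_pmull.
  by split=> //; last (apply/orP; right); lia.
have /choice[f fE] : forall h, exists i, E X e psi i /\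
    ((j0 + h) * k + 1 <= i <= (j0 + h + 1) * k)%N.
  move=> h; have [|i [Ei iE]] := EX (j0 + h)%N; last by exists i.
  by rewrite addn_gt0 j00.
have ek : (e + k <= (k + 1) * e)%N by nia.
exists ((j0 + N) * k + e)%N; split.
- by rewrite mulnDl; lia.
- by move: ek; rewrite !mulnDl; lia.
set t' := ((j0 + N) * k + e)%N => t'n del rho v vp vm rho1 lv lvp lvm vpm.
have v0 := shift_le_ge0 _ _ _ lv.
have t'0 : (0 < t')%N by rewrite /t'; lia.
pose base := index_iota t'.+1 n.+1.
pose L m := iteri m (fun h l => [:: f h, (f h + e)%N & l]) base.
(* The ranges hold the left members, the right members and the tail beyond [t']. *)
have memL m : (m <= N)%N -> forall x, x \in L m ->
    [\/ (j0 * k < x <= (j0 + m) * k)%N, (j0 * k + e < x <= (j0 + m) * k + e)%N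
      | (t' < x <= n)%N].
  elim: m => [|m IHm] mN x; first by rewrite /L /= mem_index_iota ltnS; constructor 3.
  have [_ fm] := fE m; rewrite /L /= !inE => /or3P[/eqP->|/eqP->|].
  - by constructor 1; move: fm; rewrite !mulnDl; lia.
  - by constructor 2; move: fm; rewrite !mulnDl; lia.
  - move=> /(IHm (ltnW mN)) [xm|xm|xm].
    + by constructor 1; move: xm; rewrite !mulnDl; lia.
    + by constructor 2; move: xm; rewrite !mulnDl; lia.
    + by constructor 3.
have L1 m : (m <= N)%N -> forall x, x \in L m -> (t < x <= n)%N.
  move=> mN x /(memL _ mN); have mk : (m * k <= N * k)%N by rewrite leq_mul2r mN orbT.
  by move: t'n; rewrite /t' !mulnDl => t'n [] xm; lia.
have uL m : (m <= N)%N -> uniq (L m).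
  elim: m => [_|m IHm mN]; first exact: iota_uniq.
  have [_ fm] := fE m; rewrite /L /= -/(L m) IHm ?(ltnW mN)// andbT inE negb_or.
  have mk : ((m + 1) * k <= N * k)%N by rewrite leq_mul2r addn1 mN orbT.
  have Nk : m = 0%N \/ (N * k <= e)%N.
    by case/orP: Nk1 => [/eqP N1|]; [left; lia | right].
  apply/andP; split; [apply/andP; split |]; first by lia.
  - apply/negP => /(memL _ (ltnW mN)); rewrite /t'.
    by move: fm mk Nk; rewrite !mulnDl => fm mk [?|Nk] [] ?; subst; lia.
  - apply/negP => /(memL _ (ltnW mN)); rewrite /t'.
    by move: fm mk Nk; rewrite !mulnDl => fm mk [?|Nk] [] ?; subst; lia.
have aL m : (m <= N)%N -> all (leq 1) (L m).
  by move=> mN; apply/allP => x /(L1 _ mN); lia.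
pose p := psi / t'%:R.
have p0 : 0 <= p by rewrite divr_ge0// ltW.
have pq h : (h < N)%N -> p <= q X (f h) e.
  move=> hN; have [[f0 Ef] fh] := fE h; apply: le_trans Ef.
  rewrite ler_pM2l// lef_pV2 ?posrE ?ltr0n ?ler_nat//; last by lia.
  have mk : ((h + 1) * k <= N * k)%N by rewrite leq_mul2r addn1 hN orbT.
  by move: fh mk; rewrite /t' !mulnDl; lia.
have p2 : 2 * p <= 1.
  have [[f0 _] _] := fE 0%N; have := q_le_half _ e f0; have := pq _ N0; lra.
have baseL m u z : (m <= N)%N -> shift_le base u z -> shift_le (L m) u z.
  move=> mN; apply: shift_le_subset; [exact: iota_uniq | exact: uL | exact: aL |].
  move=> x xb; elim: m {mN} => // m IHm; by rewrite /L /= !inE -/(L m) IHm !orbT.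
(* After an exchange no further pair is used: the bounds [vp] and [vm] on [base] carry over to
   [L m]. *)
have step m : (m <= N)%N ->
    shift_le (L m) del (v * (rho + (1 - rho) * (1 - 2 * p) ^+ m)).
  elim: m => [_|m IHm mN]; first by rewrite expr0 mulr1 addrC subrK mulr1.
  have mN' := ltnW mN.
  have := shift_le_pair (L m) (f m) e del p _ _ _ (uL m.+1 mN) (aL m.+1 mN) _
    (IHm mN') (baseL _ _ _ mN' lvp) (baseL _ _ _ mN' lvm).
  rewrite p0 pq// => /(_ isT); apply: shift_leW.
  rewrite exprS; have := ler_wpM2l p0 vpm; lra.
apply: (shift_le_subset (L N)).
- exact: uL.
- exact: iota_uniq.
- by apply/allP => x; rewrite mem_index_iota; lia.
- by move=> x /(L1 _ (leqnn N)); rewrite mem_index_iota ltnS.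
apply: shift_leW (step N (leqnn N)); apply: ler_wpM2l => //.
set z := psi / k%:R; set b := (t + (2 * k + 2) * e)%N; set u := e%:R / b%:R.
suff : (1 - 2 * p) ^+ N <= 1 - z / (1 + z) * u.
  move=> h; have r0 : 0 <= 1 - rho by rewrite subr_ge0.
  by have := ler_wpM2l r0 h; lra.
have z0 : 0 < z by rewrite divr_gt0// ltr0n.
have b0 : (0 < b)%N by rewrite /b; lia.
have u0 : 0 <= u by rewrite divr_ge0.
have u1 : u <= 1 by rewrite ler_pdivrMr ?ltr0n// mul1r ler_nat /b; nia.
(* Here [p = psi / t'] with [t' <= b], and [2 N >= e / k]. *)
have zu : z * u <= N%:R * (2 * p).
  have t'b : (t' <= b)%N.
    by move: ek; rewrite /t' /b !mulnDl; lia.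
  have -> : z * u = psi / b%:R * (e%:R / k%:R) by rewrite /z /u; ring.
  have -> : N%:R * (2 * p) = psi / t'%:R * (2 * N%:R) by rewrite /p; ring.
  apply: ler_pM => //.
  - by rewrite divr_ge0// ltW.
  - by rewrite ler_pM2l// lef_pV2 ?posrE ?ltr0n// ler_nat.
  - by rewrite ler_pdivrMr ?ltr0n// -!natrM ler_nat -mulnA.
have := exprBn_le _ (2 * p) N; rewrite mulr_ge0// p2 => /(_ isT) hN.
have zu0 : 0 <= z * u by rewrite mulr_ge0// ltW.
have hN' : (1 - 2 * p) ^+ N <= (1 + z * u)^-1.
  rewrite -[leRHS]mul1r ler_pdivlMr; last by lra.
  apply: le_trans hN; apply: ler_wpM2l; last by lra.
  by apply: exprn_ge0; lra.
(* [1 / (1 + z u)] is convex in [u], so on [0, 1] it lies below its chord [1 - z / (1 + z) u]. *)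
apply: le_trans hN' _.
rewrite -[leLHS]mul1r ler_pdivrMr; last by lra.
set c := z / (1 + z); have cE : c * (1 + z) = z by rewrite /c divfK//; lra.
have c0 : 0 <= c by rewrite /c divr_ge0//; lra.
have : 0 <= c * u * (z * (1 - u)).
  by apply: mulr_ge0; apply: mulr_ge0; lra.
have : z * u = c * u + c * z * u by rewrite -{1}cE; ring.
lra.
Qed.

(** Induction on [n - t]: one block is consumed, [potential_contract] averages the two shifted
    potentials, and the condition on [gam] pays for moving the time from [t] to [t']. *)
Lemma shift_le_potential (r s k n : nat) (psi gam rho : R) (g : int -> R) :
  (0 < r)%N -> (0 < s)%N -> (0 < k)%N -> (0 < n)%N -> 0 < psi ->
  0 < gam -> gam <= 4^-1 -> rho < 1 ->
  (forall del, 1 <= g del <= 1 + s%:R ^+ 2) ->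
  (forall del, ~~ (s %| `|del|)%N ->
    g (del + r%:Z) + g (del - r%:Z) <= 2 * g del - 2) ->
  2 `^ (- 4^-1) <= rho -> 1 - (1 + s%:R ^+ 2) ^- 2 <= rho ->
  gam * (2 * k + 2)%:R <= (1 - rho) * ((psi / k%:R) / (1 + psi / k%:R)) ->
  (forall e j : nat, D r s e -> (1 <= j)%N ->
    E X e psi `&` [set i | (j * k + 1 <= i <= (j + 1) * k)%N] !=set0) ->
  forall (t : nat) (del : int), shift_le (index_iota t.+1 n.+1) del
    (potential R r s (2 * k + 2) gam g t del / n%:R `^ gam).
Proof.
move=> r0 s0 k0 n0 psi0 gam0 gam4 rho1 gB gH rhoA rhoB gamB EX t.
have np : 0 < n%:R `^ gam :> R by rewrite powR_gt0// ltr0n.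
have [m] := ubnP (n - t); elim: m t => // m IHm t; rewrite ltnS => ntm del.
have [->|del0] := eqVneq del 0.
  rewrite /potential /weight eqxx mulr0 mul0r; exact: shift_le0.
set e := stride r s del; have e0 : (0 < e)%N by exact: stride_gt0.
have eD : D r s e by exact: stride_D.
set B := (2 * k + 2)%N.
have w1 : 1 <= weight R r s g del by exact: weight_ge1.
have [t' [tt' t'b step]] := shift_le_block k e n t psi k0 e0 psi0 (fun j => EX e j eD).
have b0 : 0 < (t + B * e)%:R :> R by rewrite ltr0n; lia.
(* A block overrunning [n] forces [t + B e >= n], so the claimed bound is at least 1. *)
have [t'n|nt'] := leqP t' n; last first.
  apply: shift_le_ge1; rewrite ler_pdivlMr// mul1r /potential -/e -[leLHS]mulr1.
  apply: ler_pM => //.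
  apply: ge0_ler_powR; rewrite ?nnegrE ?ler_nat// ?(ltW gam0)//.
  exact: leq_trans (ltnW nt') t'b.
have IH del' : shift_le (index_iota t'.+1 n.+1) del'
    (potential R r s B gam g t' del' / n%:R `^ gam).
  by apply: IHm; lia.
apply: shift_leW (step t'n del rho _ _ _ (ltW rho1) (IH _) (IH _) (IH _) _); last first.
  rewrite -mulrDl [leRHS]mulrA ler_pM2r ?invr_gt0//.
  exact: potential_contract.
rewrite mulrAC ler_pM2r ?invr_gt0// /potential -/e mulrAC.
apply: ler_wpM2r; first by lra.
(* Since [t' <= t + B e], the new base [t' + B e] is at most [(t + B e) (1 + B u)]; [powR_decay]
   absorbs [1 + B u]. *)
set u := e%:R / _; have u0 : 0 <= u by rewrite divr_ge0.
apply: le_trans (@powR_decay R (t + B * e)%:R (B%:R * u) _ gam (ltW b0) _ (ltW gam0) _).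
- apply: ler_wpM2r.
    have rho0 : 0 <= rho by exact: le_trans rhoA.
    have u1 : u <= 1.
      rewrite ler_pdivrMr// mul1r ler_nat (leq_trans _ (leq_addl _ _))//.
      by rewrite leq_pmull// addn_gt0 orbT.
    have : 0 < psi / k%:R by rewrite divr_gt0// ltr0n.
    set z := psi / k%:R => z0.
    have c1 : z / (1 + z) <= 1 by rewrite ler_pdivrMr; lra.
    have c0 : 0 <= z / (1 + z) by rewrite divr_ge0//; lra.
    have cu1 : z / (1 + z) * u <= 1 by rewrite mulr_ile1.
    have cu0 : 0 <= z / (1 + z) * u by rewrite mulr_ge0.
    by rewrite subr_ge0 mulr_ile1//; lra.
  apply: ge0_ler_powR; rewrite ?nnegrE ?(ltW gam0)//.
    by rewrite mulr_ge0 ?(ltW b0)// addr_ge0// mulr_ge0.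
  rewrite mulrDr mulr1 /u mulrCA [_ * (_ / _)]mulrC divfK ?gt_eqF//.
  by rewrite -natrM -natrD ler_nat; lia.
- by rewrite mulr_ge0.
- by rewrite mulrA [leRHS]mulrA ler_wpM2r.
Qed.

End shifted_sums.

(** * Choice of constants and conclusion *)

Theorem theorem2p1 (R : realType) (r s k : nat) (psi : R)
    (r_gt0 : (0 < r)%N) (s_gt0 : (0 < s)%N) (rs_coprime : coprime r s)
    (k_gt0 : (0 < k)%N) (psi_gt0 : 0 < psi) :
  exists C gamma : R, [/\ 0 < C, 0 < gamma &
    forall (d : measure_display) (T : measurableType d) (P : probability T R)
      (X : nat -> {RV P >-> nat}),
      independent_RVs [set i : nat | (1 <= i)%N] X ->
      (forall e j : nat, D r s e -> (1 <= j)%N ->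
        E X e psi `&` [set i | (j * k + 1 <= i <= (j + 1) * k)%N] !=set0) ->
      forall a n : nat, (a < n)%N -> (a + 1)%:R <= C * n%:R ->
        d_TV (distribution P (partial_sum X a n))
             (distribution P (add_one (partial_sum X a n)))
        <= 6 * ((a + 1)%:R / n%:R) `^ gamma].
Proof.
have [g [gB gH]] := exists_hitting_weight R r s s_gt0 rs_coprime.
(* The larger of the contraction factors for steps at multiples of [s] and for the search for
   one. *)
pose rho : R := Num.max (2 `^ (- 4^-1)) (1 - (1 + s%:R ^+ 2) ^- 2).
have rho1 : rho < 1.
  rewrite gt_max; apply/andP; split.
    rewrite powRN invf_lt1 ?powR_gt0//.
    have := @gt0_ltr_powR R 4^-1 _ 1 2; rewrite powR1; apply; rewrite ?nnegrE//.
    by rewrite ltr1n.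
  by rewrite ltrBlDr ltrDl invr_gt0 exprn_gt0.
pose B := (2 * k + 2)%N; pose c := (psi / k%:R) / (1 + psi / k%:R).
have Bn : (0 < B)%N by rewrite addn_gt0 orbT.
have B0 : 0 < B%:R :> R by rewrite ltr0n.
have c0 : 0 < c.
  have pk : 0 < psi / k%:R by rewrite divr_gt0// ltr0n.
  by rewrite divr_gt0//; lra.
(* [1/4] serves the stride decay; the other term lets the gain of a block outweigh the growth of the
   time factor. *)
pose gam := Num.min 4^-1 ((1 - rho) * c / B%:R).
have gam0 : 0 < gam.
  by rewrite lt_min invr_gt0 ltr0n /= divr_gt0// mulr_gt0// subr_gt0.
have gam4 : gam <= 4^-1 by rewrite ge_min lexx.
have gamB : gam * B%:R <= (1 - rho) * c by rewrite -ler_pdivlMr// ge_min lexx orbT.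
(* [K (a + 1)^gam] bounds the potential at [(a, 1)], because [a + B e <= (a + 1) B e] for the stride
   [e] of 1. *)
pose K := (B * stride r s 1)%:R `^ gam * weight R r s g 1.
have d0 : (0 < stride r s 1)%N by exact: stride_gt0.
have w1 : 1 <= weight R r s g 1 by exact: weight_ge1.
have K0 : 0 < K.
  by rewrite mulr_gt0 ?powR_gt0 ?ltr0n ?muln_gt0 ?Bn//; exact: lt_le_trans w1.
(* Half of the exponent is spent on the constant: [x <= C] gives [K x^(gam/2) <= 6], which leaves
   [6 x^(gam/2)]. *)
exists ((6 / K) `^ (2 / gam)), (gam / 2); split; first by rewrite powR_gt0// divr_gt0.
  by rewrite divr_gt0.
move=> d T P X indepX EX a n an aC.
have n0 : 0 < n%:R :> R by rewrite ltr0n (leq_ltn_trans _ an).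
pose x : R := (a + 1)%:R / n%:R; have x0 : 0 <= x by rewrite divr_ge0.
have xC : x <= (6 / K) `^ (2 / gam) by rewrite ler_pdivrMr.
have bound : shift_le P X (index_iota a.+1 n.+1) 1 (6 * x `^ (gam / 2)).
  apply: (@shift_leW _ _ _ _ _ _ _ (potential R r s B gam g a 1 / n%:R `^ gam));
    last first.
    apply: (@shift_le_potential _ _ _ _ _ _ _ _ _ _ psi gam rho) => //.
    - by rewrite -(ltr0n R).
    - by rewrite le_max lexx.
    - by rewrite le_max lexx orbT.
  apply: (@le_trans _ _ (K * x `^ gam)).
    rewrite ler_pdivrMr ?powR_gt0// -mulrA -powRM ?ler0n// divfK ?gt_eqF//.
    rewrite /potential /K mulrAC ler_wpM2r//; first by lra.
    rewrite -powRM// -natrM; apply: ge0_ler_powR; rewrite ?nnegrE ?(ltW gam0)//.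
    by rewrite ler_nat addn1 mulnS addnC leq_add2l leq_pmull// muln_gt0 Bn.
  have -> : x `^ gam = x `^ (gam / 2) * x `^ (gam / 2).
    rewrite -powRD; first by congr (_ `^ _); lra.
    by rewrite [_ == _]gt_eqF// addr_gt0 ?divr_gt0.
  rewrite mulrA; apply: ler_wpM2r; first exact: powR_ge0.
  have K6 : 0 <= 6 / K by rewrite divr_ge0// ltW.
  have : x `^ (gam / 2) <= ((6 / K) `^ (2 / gam)) `^ (gam / 2).
    by apply: ge0_ler_powR; rewrite ?nnegrE ?powR_ge0 ?divr_ge0 ?(ltW gam0).
  rewrite -powRrM (_ : 2 / gam * (gam / 2) = 1) ?powRr1//; last first.
    by field; rewrite gt_eqF.
  by move=> xg; rewrite mulrC -ler_pdivlMr.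
apply: ge_sup; first by exists `|fine (distribution P (partial_sum X a n) set0) -
  fine (distribution P (add_one (partial_sum X a n)) set0)|, set0.
move=> _ [A _ <-].
(* Complements turn the one-sided bound into a bound on the absolute difference. *)
have prC (U : set T) : measurable U -> pr P (~` U) = 1 - pr P U.
  move=> mU; have := pr_setIC P setT U measurableT mU.
  by rewrite !setTI pr_setT; lra.
pose U := [set w | A (sum_over P X (index_iota a.+1 n.+1) w)].
pose U' := [set w | A (sum_over P X (index_iota a.+1 n.+1) w + 1)].
have mU : measurable U by exact: measurable_sum_over_event.
have mU' : measurable U'.
  exact: (measurable_sum_over_event _ _ _ [set z | A (z + 1)]).
have h1 : pr P U <= pr P U' + 6 * x `^ (gam / 2) := bound A.
have h2 : pr P (~` U) <= pr P (~` U') + 6 * x `^ (gam / 2) := bound (~` A).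
rewrite !prC// in h2.
rewrite -[fine (distribution P (partial_sum X a n) A)]/(pr P U).
rewrite -[fine (distribution P (add_one (partial_sum X a n)) A)]/(pr P U').
by rewrite ler_norml; lra.
Qed.
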